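(* Let $s$ be a state with deviations $w_1,w_2,w_3\in\mathbb C$ (so $\sum_ix_iw_i=0$), and write $P_{ij}:=\operatorname{Im}(\bar w_iw_j)$. Then: (a) $A_\perp^2=P_{12}^2+P_{13}^2+P_{23}^2$. (b) There is $c\in\mathbb R$ with $$(P_{23},\,-P_{13},\,P_{12})=c\,(x_1,x_2,x_3),\qquad |c|=\frac{A_\perp}{|\xi|}=\frac{\delta}{2|\xi|^2}.$$ (c) Consequently the plane lattice $\mathbb Zw_2+\mathbb Zw_3\subset\mathbb C$ has covolume exactly $$\operatorname{covol}(\mathbb Zw_2+\mathbb Zw_3)=|P_{23}|=\frac{\delta\,x_1}{2|\xi|^2},$$ and cyclically for the other two pairs, i.e. $\operatorname{covol}(\mathbb Zw_1+\mathbb Zw_3)=|P_{13}|=\delta x_2/(2|\xi|^2)$ and $\operatorname{covol}(\mathbb Zw_1+\mathbb Zw_2)=|P_{12}|=\delta x_3/(2|\xi|^2)$.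
   Context: $K$ is a cubic number field of signature $(1,1)$, with real embedding $\sigma_r$ and complex embedding $\sigma_c$; $L\subset\mathcal O_K$ is an order. A state is an ordered triple $s=(u_1,u_2,u_3)$ of elements of $L$ forming a $\mathbb Q$-basis of $K$ with $x_i=\sigma_r(u_i)>0$, sorted so that $x_1\ge x_2\ge x_3>0$. Put $\xi=(x_1,x_2,x_3)$, $\nu=(\sigma_c(u_1),\sigma_c(u_2),\sigma_c(u_3))=a+ib$ with $a,b\in\mathbb R^3$, and $\delta=2|\det(\xi,a,b)|=|\mathrm{disc}(u_1,u_2,u_3)|^{1/2}$. With $\hat\xi=\xi/|\xi|$, $a_\perp=a-\langle a,\hat\xi\rangle\hat\xi$, $b_\perp=b-\langle b,\hat\xi\rangle\hat\xi$, set $A_\perp=|a_\perp\times b_\perp|$. Let $\bar\zeta=\langle\xi,\nu\rangle/|\xi|^2\in\mathbb C$ (bilinear dot product; the bar is part of the symbol, not a complex conjugation) and define the deviations $w_i=\sigma_c(u_i)-\bar\zeta x_i$; then $\sum_ix_iw_i=0$ and $(w_1,w_2,w_3)=a_\perp+ib_\perp$. *)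

(* Defs.v *)
From HB Require Import structures.
From mathcomp Require Import all_boot all_order all_algebra all_field.
From mathcomp Require Import complex ring.
From mathcomp Require Import all_classical all_reals all_analysis.
Set Implicit Arguments.
Unset Strict Implicit.
Unset Printing Implicit Defensive.
Import Order.TTheory GRing.Theory Num.Theory.
Local Open Scope classical_set_scope.
Local Open Scope ring_scope.
Local Open Scope card_scope.
Local Open Scope complex_scope.

Definition embeddings (R : realType) (K : fieldExtType rat) : set (K -> R[i]) :=
  [set f : K -> R[i] | exists g : {rmorphism K -> R[i]}, f = g :> (K -> R[i])].

Definition real_embedding (R : realType) (K : fieldExtType rat) (f : K -> R[i]) : Prop :=
  forall x, complex.Im (f x) = 0.

(* [r2] counts pairs of conjugate nonreal embeddings, hence the cardinal 2 r2. *)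
Definition has_signature (R : realType) (K : fieldExtType rat) (r1 r2 : nat) : Prop :=
  (@embeddings R K `&` [set f | real_embedding f]) #= `I_r1 /\
  (@embeddings R K `&` [set f | ~ real_embedding f]) #= `I_(2 * r2).

Definition algebraic_integer (K : fieldExtType rat) (x : K) : Prop :=
  integralOver (intr : int -> K) x.

(* A subring of the ring of integers that is free over Z on a Q-basis of K. *)
Definition is_order (K : fieldExtType rat) (L : {pred K}) : Prop :=
  [/\ subring_closed L,
      (forall x, x \in L -> algebraic_integer x)
    & exists e : (\dim {:K}).-tuple K, basis_of {:K} e /\
        forall x, x \in L <->
          exists m : 'I_(\dim {:K}) -> int, x = \sum_i (tnth e i) *~ m i].

(* The mathematical indices 1, 2, 3 of a triple. *)
Definition i1 : 'I_3 := @Ordinal 3 0 isT.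
Definition i2 : 'I_3 := @Ordinal 3 1 isT.
Definition i3 : 'I_3 := @Ordinal 3 2 isT.

Definition row3 (T : Type) (a b c : T) : 'rV[T]_3 :=
  \row_j tnth [tuple a; b; c] j.

Definition dot (A : pzRingType) (v w : 'rV[A]_3) : A := \sum_i v 0 i * w 0 i.

(* Euclidean: the library norm on matrices is the sup norm. *)
Definition norm2 (R : realType) (v : 'rV[R]_3) : R := Num.sqrt (dot v v).

Definition cross (A : pzRingType) (v w : 'rV[A]_3) : 'rV[A]_3 :=
  row3 (v 0 i2 * w 0 i3 - v 0 i3 * w 0 i2)
       (v 0 i3 * w 0 i1 - v 0 i1 * w 0 i3)
       (v 0 i1 * w 0 i2 - v 0 i2 * w 0 i1).

Definition det3 (A : comPzRingType) (u v w : 'rV[A]_3) : A :=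
  \det (\matrix_(k < 3) tnth [tuple u; v; w] k).

Section States.
Context (R : realType) (K : fieldExtType rat).
Context (sr : {rmorphism K -> R}) (sc : {rmorphism K -> R[i]}).

Record is_state (L : {pred K}) (s : 3.-tuple K) : Prop := IsState {
  state_in : forall i, tnth s i \in L;
  state_basis : basis_of {:K} s;
  state_pos : forall i, 0 < sr (tnth s i);
  state_sorted : forall i j : 'I_3, (i <= j)%N -> sr (tnth s j) <= sr (tnth s i)
}.

Variable s : 3.-tuple K.

Definition xi : 'rV[R]_3 := \row_i sr (tnth s i).
Definition nu : 'rV[R[i]]_3 := \row_i sc (tnth s i).
Definition re_nu : 'rV[R]_3 := map_mx (@complex.Re R) nu.
Definition im_nu : 'rV[R]_3 := map_mx (@complex.Im R) nu.

Definition delta : R := 2 * `|det3 xi re_nu im_nu|.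

Definition xi_hat : 'rV[R]_3 := (norm2 xi)^-1 *: xi.
Definition perp (v : 'rV[R]_3) : 'rV[R]_3 := v - dot v xi_hat *: xi_hat.
Definition A_perp : R := norm2 (cross (perp re_nu) (perp im_nu)).

(* Bilinear, not Hermitian, product of xi and nu. *)
Definition zeta_bar : R[i] :=
  dot (map_mx (real_complex R) xi) nu / (norm2 xi ^+ 2)%:C.

Definition dev (i : 'I_3) : R[i] := nu 0 i - zeta_bar * (xi 0 i)%:C.

Definition P (i j : 'I_3) : R := complex.Im ((dev i)^* * dev j).

End States.

Section PlaneLattices.
Context (R : realType).

Definition Zspan (v w : R[i]) : set R[i] :=
  [set z | exists m n : int, z = v *~ m + w *~ n].

Definition plane_lattice (Lam : set R[i]) : Prop :=
  exists v w : R[i],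
    (forall a b : R, a%:C * v + b%:C * w = 0 -> a = 0 /\ b = 0) /\
    Lam = Zspan v w.

Definition plane_set (F : set R[i]) : set (measurableTypeR R * measurableTypeR R) :=
  [set p | F (p.1 +i* p.2)].

Definition area (F : set R[i]) : \bar R :=
  ((@lebesgue_measure R) \x (@lebesgue_measure R))%E (plane_set F).

Definition fundamental_domain (Lam F : set R[i]) : Prop :=
  measurable (plane_set F) /\
  forall z : R[i], exists! l : R[i], Lam l /\ F (z - l).

(* The covolume is the area of C / Lam: the common area of all measurable
   fundamental domains, the existence of one being part of the definition. *)
Definition has_covolume (Lam : set R[i]) (v : R) : Prop :=
  (exists F, fundamental_domain Lam F) /\
  (forall F, fundamental_domain Lam F -> area F = v%:E).

End PlaneLattices.

Definition disc (R : realType) (K : fieldExtType rat) (sr : {rmorphism K -> R})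
    (sc : {rmorphism K -> R[i]}) (s : 3.-tuple K) : R[i] :=
  det3 (map_mx (real_complex R) (xi sr s)) (nu sc s) (map_mx conjc (nu sc s)) ^+ 2.

Lemma sum3E (V : nmodType) (F : 'I_3 -> V) : \sum_i F i = F i1 + F i2 + F i3.
Proof.
rewrite !big_ord_recl big_ord0 addr0 addrA.
by congr (F _ + F _ + F _); apply: val_inj.
Qed.

Lemma tnth3E (T : Type) (a b c : T) :
  ((tnth [tuple a; b; c] i1 = a) * (tnth [tuple a; b; c] i2 = b) *
   (tnth [tuple a; b; c] i3 = c))%type.
Proof. by []. Qed.

Lemma det3E (A : comPzRingType) (u v w : 'rV[A]_3) :
  det3 u v w = dot u (cross v w).
Proof.
pose f k j := tnth [tuple u; v; w] (inord k) 0 (inord j).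
have fE (k j : 'I_3) : tnth [tuple u; v; w] k 0 j = f k j by rewrite /f !inord_val.
have := (fE i1, fE i2, fE i3); rewrite !tnth3E => uvwE.
rewrite /det3 /dot sum3E (expand_det_row _ i1) sum3E /cofactor.
rewrite !(expand_det_row _ ord0) !big_ord_recl !big_ord0 /cofactor !det_mx11.
rewrite !mxE !tnth3E !uvwE ?fE /bump /=; ring.
Qed.

Lemma dotvv_ge0 (R : realType) (v : 'rV[R]_3) : 0 <= dot v v.
Proof. by apply: sumr_ge0 => i _; rewrite -expr2 sqr_ge0. Qed.

Lemma norm2_sq (R : realType) (v : 'rV[R]_3) : norm2 v ^+ 2 = dot v v.
Proof. by rewrite /norm2 sqr_sqrtr // dotvv_ge0. Qed.

Lemma dot_xi_gt0 (R : realType) (K : fieldExtType rat) (sr : {rmorphism K -> R})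
    (L : {pred K}) (s : 3.-tuple K) :
  is_state sr L s -> 0 < dot (xi sr s) (xi sr s).
Proof.
move=> [_ _ pos _]; rewrite /dot sum3E !mxE.
by rewrite !addr_gt0 ?mulr_gt0.
Qed.

(* The deviations are the coordinates of a_perp + i b_perp. *)
Lemma dev_perp (R : realType) (K : fieldExtType rat) (sr : {rmorphism K -> R})
    (sc : {rmorphism K -> R[i]}) (L : {pred K}) (s : 3.-tuple K) (i : 'I_3) :
  is_state sr L s ->
  dev sr sc s i = perp sr s (re_nu sc s) 0 i +i* perp sr s (im_nu sc s) 0 i.
Proof.
move=> hs; have x0 := dot_xi_gt0 hs.
have xiE j : xi_hat sr s 0 j = (norm2 (xi sr s))^-1 * xi sr s 0 j by rewrite !mxE.
have nE j : nu sc s 0 j = re_nu sc s 0 j +i* im_nu sc s 0 j.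
  by rewrite !mxE; case: (sc _).
have h v j : dot v (xi_hat sr s) * xi_hat sr s 0 j =
    dot v (xi sr s) / dot (xi sr s) (xi sr s) * xi sr s 0 j.
  rewrite -norm2_sq xiE expr2 invfM /dot !sum3E !xiE; ring.
have -> : perp sr s (re_nu sc s) 0 i = re_nu sc s 0 i -
   dot (re_nu sc s) (xi sr s) / dot (xi sr s) (xi sr s) * xi sr s 0 i.
  by rewrite -h [LHS]mxE [X in _ + X]mxE [X in _ - X]mxE.
have -> : perp sr s (im_nu sc s) 0 i = im_nu sc s 0 i -
   dot (im_nu sc s) (xi sr s) / dot (xi sr s) (xi sr s) * xi sr s 0 i.
  by rewrite -h [LHS]mxE [X in _ + X]mxE [X in _ - X]mxE.
have zE : zeta_bar sr sc s =
    (dot (re_nu sc s) (xi sr s) / dot (xi sr s) (xi sr s)) +i*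
    (dot (im_nu sc s) (xi sr s) / dot (xi sr s) (xi sr s)).
  have mE j : map_mx (real_complex R) (xi sr s) 0 j = (xi sr s 0 j)%:C by rewrite mxE.
  rewrite /zeta_bar norm2_sq -fmorphV /dot !sum3E !nE !mE.
  by apply/eqP; rewrite eq_complex /=; apply/andP; split; apply/eqP; ring.
rewrite /dev zE nE.
by apply/eqP; rewrite eq_complex /=; apply/andP; split; apply/eqP; ring.
Qed.

Lemma sum_dev (R : realType) (K : fieldExtType rat) (sr : {rmorphism K -> R})
    (sc : {rmorphism K -> R[i]}) (L : {pred K}) (s : 3.-tuple K) :
  is_state sr L s -> \sum_i (xi sr s 0 i)%:C * dev sr sc s i = 0.
Proof.
move=> hs; have x0 := dot_xi_gt0 hs.
have d0 : (dot (xi sr s) (xi sr s))%:C != 0.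
  by apply/eqP => -[] /eqP; rewrite gt_eqF.
rewrite /dev /zeta_bar norm2_sq.
under eq_bigr => i _ do rewrite mulrBr mulrCA.
rewrite sumrB -mulr_sumr.
have -> : \sum_i (xi sr s 0 i)%:C * (xi sr s 0 i)%:C = (dot (xi sr s) (xi sr s))%:C.
  by rewrite /dot raddf_sum; apply: eq_bigr => i _; rewrite -rmorphM.
rewrite divfK // /dot; apply/eqP; rewrite subr_eq0; apply/eqP.
by apply: eq_bigr => i _; rewrite [map_mx _ _ _ _]mxE.
Qed.

(* delta = |disc|^(1/2); the discriminant is negative in signature (1, 1). *)
Lemma disc_delta (R : realType) (K : fieldExtType rat) (sr : {rmorphism K -> R})
    (sc : {rmorphism K -> R[i]}) (s : 3.-tuple K) :
  disc sr sc s = (- delta sr sc s ^+ 2)%:C.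
Proof.
have nE j : nu sc s 0 j = re_nu sc s 0 j +i* im_nu sc s 0 j.
  by rewrite !mxE; case: (sc _).
have mE j : map_mx (real_complex R) (xi sr s) 0 j = (xi sr s 0 j)%:C by rewrite mxE.
have cE j : map_mx conjc (nu sc s) 0 j = re_nu sc s 0 j -i* im_nu sc s 0 j.
  by rewrite mxE nE.
rewrite /disc /delta exprMn real_normK ?num_real // !det3E /dot !sum3E /cross.
rewrite ![row3 _ _ _ _ _]mxE !tnth3E !nE !mE !cE.
by apply/eqP; rewrite eq_complex /=; apply/andP; split; apply/eqP; ring.
Qed.

(* Main.v *)
Require Import Defs.
From HB Require Import structures.
From mathcomp Require Import all_boot all_order all_algebra all_field.
From mathcomp Require Import complex.
From mathcomp Require Import all_classical all_reals all_analysis.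
From mathcomp Require Import ring.
Import Order.TTheory GRing.Theory Num.Theory.
Local Open Scope ring_scope.
Local Open Scope classical_set_scope.
Local Open Scope complex_scope.

(** The three products P_ij are, up to order and sign, the coordinates of the
cross product of the projections a_perp and b_perp: by [dev_perp] the deviation
w_i is a_perp_i + i b_perp_i, so Im (conj w_i * w_j) is a 2 x 2 minor of
(a_perp, b_perp) ([cross_dev]). Taking norms gives (a). Both projections are
orthogonal to xi, so their cross product is a multiple c xi; pairing with xi
and noting that projecting along xi does not change the determinant gives
c = det (xi, a, b) / |xi|^2 ([cross_perp]), which is (b) and the numerical
values in (c).

For (c) it must also be shown that each P_ij is nonzero and that |P_ij| is the
area of every measurable fundamental domain of the lattice.

The first fact amounts to det (xi, a, b) <> 0. A linear relation between the
three rows extends from the basis s to a relation between sr, Re sc and Im sc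
on all of K, and Dedekind's independence of characters excludes it
([embedding_combination_eq0], [det_embeddings_neq0]).

The second fact has two halves. Any two measurable fundamental domains F, G of
a countable group of translations have the same area, as F is cut by the
translates of G into countably many pieces which, translated back, tile G
([area_fundamental_domain_uniq]); this uses translation invariance of the
product measure ([plane_measure_shift]). One domain is then measured. Instead
of a parallelogram, [sheared_domain] is used: all its nonempty vertical
sections have the same length and they sit over an interval, so its area is a
product of two lengths and no change of variables in the plane is needed. *)

(** * Translation invariance of area *)

Section Plane.
Context {R : realType}.
Local Notation mu := (@lebesgue_measure R).
Local Notation RB := (measurableTypeR R).

Let shift (c : R) : RB -> RB := fun x => x + c.

Let measurable_shift c : measurable_fun setT (shift c).
Proof. by apply: measurable_realfun.measurable_funD. Qed.

Lemma lebesgue_measure_shift (c : R) (A : set RB) :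
  measurable A -> mu [set x | A (x + c)] = mu A.
Proof.
move=> mA.
pose nu0 : {measure set RB -> \bar R} := pushforward mu (shift c).
pose nu := nu0 (measurable_shift c).
suff /(_ _ mA) -> : forall B, measurable B -> mu B = nu B by [].
apply: lebesgue_measure_unique => _ [[a b] _ <-] /=.
have -> : nu `]a, b]%classic = mu `]a - c, b - c]%classic.
  congr (mu _); apply/seteqP; split=> x /=; rewrite /shift !in_itv /= ?inE.
    by rewrite ltrBlDr lerBrDr.
  by rewrite ltrBlDr lerBrDr.
rewrite !lebesgue_measure_itv /= !lte_fin ltrD2r.
by case: ifP => // _; rewrite -!EFinB; congr EFin; ring.
Qed.

(** A measure on the product is determined by its values on rectangles, and
there invariance reduces to the line. *)
Lemma plane_measure_shift (c : R * R) (A : set (RB * RB)) : measurable A ->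
  measurable [set p : RB * RB | A (p.1 + c.1, p.2 + c.2)] /\
  (mu \x mu)%E [set p : RB * RB | A (p.1 + c.1, p.2 + c.2)] = (mu \x mu)%E A.
Proof.
move=> mA.
pose T (p : RB * RB) : RB * RB := (shift c.1 p.1, shift c.2 p.2).
have mT : measurable_fun setT T.
  by apply: measurable_fun_pair; apply: (measurableT_comp (measurable_shift _)).
split; first by have := mT measurableT _ mA; rewrite setTI.
pose nu0 : {measure set (RB * RB) -> \bar R} := pushforward (mu \x mu)%E T.
pose nu := nu0 mT.
suff /(_ _ mA) -> : forall B, measurable B -> (mu \x mu)%E B = nu B by [].
apply: product_measure_unique => B C mB mC.
have -> : nu (B `*` C) = (mu \x mu)%E
    ([set x | B (x + c.1)] `*` [set y | C (y + c.2)]) by [].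
rewrite product_measure1E.
- by congr (_ * _)%E; exact: lebesgue_measure_shift.
- by have := measurable_shift c.1 measurableT _ mB; rewrite setTI.
- by have := measurable_shift c.2 measurableT _ mC; rewrite setTI.
Qed.

Lemma area_shift (F : set R[i]) (l : R[i]) : measurable (plane_set F) ->
  measurable (plane_set [set z | F (z + l)]) /\
  area [set z | F (z + l)] = area F.
Proof.
move=> mF.
suff E : plane_set [set z | F (z + l)] =
  [set p : RB * RB | plane_set F (p.1 + complex.Re l, p.2 + complex.Im l)].
  by rewrite /area E; exact: plane_measure_shift (_, _) _ mF.
by case: l => l1 l2.
Qed.

(** * Covolume of the lattice spanned by two vectors *)

(** The piece of F lying in l + G is A_n, where n is the code of l under an
injection f of the lattice into nat; translated by - l it becomes the piece
B_n of G. The A_n partition F because every point has a unique representative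
in G, and the B_n partition G because every point has one in F. *)
Lemma area_fundamental_domain_uniq (Lam F G : set R[i]) :
  countable Lam -> (forall l, Lam l -> Lam (- l)) ->
  fundamental_domain Lam F -> fundamental_domain Lam G -> area F = area G.
Proof.
move=> /countable_injP[f finj] LamN [mF hF] [mG hG].
have LN l : Lam l <-> Lam (- l).
  by split=> [/LamN//|/LamN]; rewrite opprK.
pose A n := [set z | exists l, [/\ Lam l, f l = n, F z & G (z - l)]].
pose B n := [set z | exists l, [/\ Lam l, f l = n, F (z + l) & G z]].
have fE l l' : Lam l -> Lam l' -> f l = f l' -> l = l'.
  by move=> Ll Ll'; apply: finj; rewrite inE.
have AB n : [/\ measurable (plane_set (A n)), measurable (plane_set (B n))
    & area (A n) = area (B n)].
  (* A number that is not the code of a lattice vector gives empty pieces. *)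
  have [[l [Ll fl]]|nl] := pselect (exists l, Lam l /\ f l = n); last first.
    have -> : A n = set0.
      by apply/seteqP; split=> // z [l [Ll fl _ _]]; apply: nl; exists l.
    have -> : B n = set0.
      by apply/seteqP; split=> // z [l [Ll fl _ _]]; apply: nl; exists l.
    by split; rewrite // /plane_set; exact: measurable0.
  have AE : A n = [set z | F z /\ G (z - l)].
    apply/seteqP; split=> z /=.
      by move=> [l' [Ll' fl' Fz Gz]]; rewrite (fE l l') // fl fl'.
    by move=> [Fz Gz]; exists l.
  have BE : B n = [set z | A n (z + l)].
    rewrite AE; apply/seteqP; split=> z /=; rewrite addrK.
      by move=> [l' [Ll' fl' Fz Gz]]; rewrite (fE l l') // fl fl'.
    by move=> [Fz Gz]; exists l.
  have mA : measurable (plane_set (A n)).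
    have [mG' _] := area_shift G (- l) mG.
    by rewrite AE; exact: measurableI.
  by have [mB eB] := area_shift (A n) l mA; rewrite BE.
have -> : area F = (\sum_(n <oo) area (A n))%E.
  have FE : plane_set F = \bigcup_n plane_set (A n).
    apply/seteqP; split=> [p Fp|p [n _ [l []]]] //.
    have [l [[Ll Gl] _]] := hG (p.1 +i* p.2).
    by exists (f l) => //; exists l.
  rewrite /area FE; apply: measure_semi_bigcup.
  - by move=> n; case: (AB n).
  - move=> i j _ _ [p [[l [Ll <- _ Gl]] [l' [Ll' <- _ Gl']]]].
    have [l0 [_ hl0]] := hG (p.1 +i* p.2).
    by rewrite -(hl0 l) // -(hl0 l').
  - by rewrite -FE.
have -> : area G = (\sum_(n <oo) area (B n))%E.
  have GE : plane_set G = \bigcup_n plane_set (B n).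
    apply/seteqP; split=> [p Gp|p [n _ [l []]]] //.
    have [l [[Ll Fl] _]] := hF (p.1 +i* p.2).
    by exists (f (- l)) => //; exists (- l); split=> //; exact: LamN.
  rewrite /area GE; apply: measure_semi_bigcup.
  - by move=> n; case: (AB n).
  - move=> i j _ _ [p [[l [Ll <- Fl _]] [l' [Ll' <- Fl' _]]]].
    have [l0 [_ hl0]] := hF (p.1 +i* p.2).
    have e1 : l0 = - l by apply: hl0; rewrite opprK -LN.
    have e2 : l0 = - l' by apply: hl0; rewrite opprK -LN.
    by congr f; apply: oppr_inj; rewrite -e1 -e2.
  - by rewrite -GE.
by apply: eq_eseriesr => n _; case: (AB n).
Qed.

Lemma measure_affine_unit (a b : R) : a != 0 ->
  measurable ([set y | 0 <= a * y + b < 1] : set RB) /\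
  mu [set y | 0 <= a * y + b < 1] = (`|a|^-1)%:E.
Proof.
move=> a0; have [an|ap|/eqP] := ltrgtP a 0; last by rewrite (negbTE a0).
- have -> : [set y | 0 <= a * y + b < 1] = `](1 - b) / a, - b / a]%classic.
    apply/seteqP; split=> y; rewrite /= in_itv /= ltr_ndivrMr // ler_ndivlMr //;
    by rewrite ltrBrDr -lerBlDr sub0r [y * a]mulrC andbC.
  split; first exact: measurable_itv.
  rewrite lebesgue_measure_itv /= lte_fin.
  rewrite ltr_nM2r ?invr_lt0 // ltrDr ltr01 -EFinB.
  by congr EFin; rewrite ltr0_norm // invrN; ring.
- have -> : [set y | 0 <= a * y + b < 1] = `[- b / a, (1 - b) / a[%classic.
    apply/seteqP; split=> y; rewrite /= in_itv /= ltr_pdivlMr // ler_pdivrMr //;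
    by rewrite ltrBrDr -lerBlDr sub0r [y * a]mulrC.
  split; first exact: measurable_itv.
  rewrite lebesgue_measure_itv /= lte_fin.
  rewrite ltr_pM2r ?invr_gt0 // ltrDr ltr01 -EFinB.
  by congr EFin; rewrite gtr0_norm //; ring.
Qed.

Lemma measurable_strip (a b : R) :
  measurable [set p : RB * RB | 0 <= a * p.1 + b * p.2 < 1].
Proof.
have m : measurable_fun setT (fun p : RB * RB => a * p.1 + b * p.2 : RB).
  apply: measurable_realfun.measurable_funD;
  by apply: measurable_realfun.measurable_funM.
have := m measurableT `[0, 1[%classic (measurable_itv _).
by rewrite setTI; congr measurable; apply/seteqP; split=> p; rewrite /= in_itv.
Qed.

Lemma Im_conjM (v w : R[i]) : complex.Im (v^* * w) =
  complex.Re v * complex.Im w - complex.Im v * complex.Re w.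
Proof. by case: v w => [a b] [c d] /=; ring. Qed.

Lemma Zspan_coord (v w : R[i]) (m n : int) :
  (complex.Re (v *~ m + w *~ n) = complex.Re v * m%:~R + complex.Re w * n%:~R) *
  (complex.Im (v *~ m + w *~ n) = complex.Im v * m%:~R + complex.Im w * n%:~R).
Proof. by rewrite !mulrzr !raddfD !raddfMz. Qed.

Lemma in01_floor (x : R) (m : int) : (0 <= x - m%:~R < 1) = (m == Num.floor x).
Proof.
rewrite subr_ge0 ltrBlDl eq_sym.
apply/idP/eqP => [h|<-].
  by apply: floor_def; rewrite intrD addrC [1%:~R + _]addrC.
by have := lt_succ_floor x; rewrite ge_floor intrD.
Qed.

(** In the coordinates z = s v + t w, with x = Re z, the second condition says
that t lies in [0, 1). For the fundamental parallelogram the first would be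
the same condition on s; here it is put on x / Re v = s + t Re w / Re v, which
differs from s by a function of t. This shear makes the projection to the real
axis an interval of length |Re v|. *)
Definition sheared_domain (v w : R[i]) : set R[i] :=
  [set z | 0 <= (complex.Re v)^-1 * complex.Re z < 1 /\
           0 <= - (complex.Im v / complex.Im (v^* * w)) * complex.Re z
                + complex.Re v / complex.Im (v^* * w) * complex.Im z < 1].

(** Subtracting m v + n w lowers t by n, which forces n to be the floor of t;
once n is known, m is the floor of a number that depends on z and n. *)
Lemma fundamental_sheared (v w : R[i]) :
  complex.Re v != 0 -> complex.Im (v^* * w) != 0 ->
  fundamental_domain (Zspan v w) (sheared_domain v w).
Proof.
move=> v0 D0; split.
  apply: measurableI; last exact: measurable_strip.
  have := measurable_strip (complex.Re v)^-1 0.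
  by congr measurable; apply/seteqP; split=> p /=; rewrite mul0r addr0.
move=> z; move: D0; set D := complex.Im (v^* * w) => D0.
have DE : D = complex.Re v * complex.Im w - complex.Im v * complex.Re w.
  exact: Im_conjM.
pose n0 := Num.floor (- (complex.Im v / D) * complex.Re z
                      + complex.Re v / D * complex.Im z).
pose m0 (n : int) := Num.floor ((complex.Re v)^-1 * complex.Re z
                      - complex.Re w / complex.Re v * n%:~R).
have domE m n : sheared_domain v w (z - (v *~ m + w *~ n)) <->
    n = n0 /\ m = m0 n.
  rewrite /sheared_domain /= -/D !raddfB /= !Zspan_coord.
  have -> : (complex.Re v)^-1 *
      (complex.Re z - (complex.Re v * m%:~R + complex.Re w * n%:~R)) =
      (complex.Re v)^-1 * complex.Re z - complex.Re w / complex.Re v * n%:~R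
      - m%:~R by field.
  have -> : - (complex.Im v / D) *
      (complex.Re z - (complex.Re v * m%:~R + complex.Re w * n%:~R)) +
      complex.Re v / D *
      (complex.Im z - (complex.Im v * m%:~R + complex.Im w * n%:~R)) =
      - (complex.Im v / D) * complex.Re z + complex.Re v / D * complex.Im z
      - n%:~R.
    (* n is written as n D / D, with the numerator D expanded. *)
    rewrite [X in _ = _ - X](_ : _ = (complex.Re v * complex.Im w
      - complex.Im v * complex.Re w) / D * n%:~R); first by ring.
    by rewrite -DE divff // mul1r.
  rewrite !in01_floor; split=> [[/eqP-> /eqP->]|[-> ->]] //.
exists (v *~ m0 n0 + w *~ n0); split.
  by split; [exists (m0 n0), n0 | apply/domE].
by move=> _ [[m [n ->]] /domE[-> ->]].
Qed.

(** Over an interval of length |Re v| every vertical section has length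
|D / Re v|, where D = Im (conj v * w). *)
Lemma area_sheared (v w : R[i]) :
  complex.Re v != 0 -> complex.Im (v^* * w) != 0 ->
  area (sheared_domain v w) = `|complex.Im (v^* * w)|%:E.
Proof.
move=> v0; set D := complex.Im _ => D0.
pose I := [set x : RB | 0 <= (complex.Re v)^-1 * x + 0 < 1].
have [mI muI] : measurable I /\ mu I = `|(complex.Re v)^-1|^-1%:E.
  by apply: measure_affine_unit; rewrite invr_neq0.
have sectionE x : mu (xsection (plane_set (sheared_domain v w)) x) =
    if x \in I then (`|complex.Re v / D|^-1)%:E else 0%E.
  case: ifPn => [/set_mem xI|/negP xI].
    have vD : complex.Re v / D != 0 by rewrite mulf_neq0 // invr_neq0.
    have [_ <-] := measure_affine_unit _ (- (complex.Im v / D) * x) vD.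
    congr (mu _); apply/seteqP; split=> y; rewrite /xsection /= inE /plane_set /=.
      by move=> [_]; rewrite addrC.
    by move=> h; split; [move: xI; rewrite /I /= addr0 | rewrite addrC].
  rewrite (_ : xsection _ _ = set0) ?measure0 //.
  apply/seteqP; split=> y //; rewrite /xsection /= inE => -[xI' _].
  by apply: xI; rewrite inE /I /= addr0.
rewrite /area /product_measure1.
rewrite (eq_integral (fun x => if x \in I then (`|complex.Re v / D|^-1)%:E else 0%E));
  last by move=> x _; exact: sectionE.
rewrite -integral_mkcond integral_cst // [X in (_ * X)%E]muI.
rewrite -EFinM; congr EFin.
by rewrite !normfV normrM normfV invrK invfM invrK; field; rewrite normr_eq0.
Qed.

Lemma ZspanC (v w : R[i]) : Zspan v w = Zspan w v.
Proof.
by apply/seteqP; split=> z [m [n ->]]; exists n, m; rewrite addrC.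
Qed.

Lemma countable_Zspan (v w : R[i]) : countable (Zspan v w).
Proof.
have -> : Zspan v w = (fun p : int * int => v *~ p.1 + w *~ p.2) @` setT.
  apply/seteqP; split=> z; first by move=> [m [n ->]]; exists (m, n).
  by move=> [[m n] _ <-]; exists m, n.
exact: card_le_trans (card_image_le _ _) (countableP _).
Qed.

Lemma Zspan_opp (v w l : R[i]) : Zspan v w l -> Zspan v w (- l).
Proof.
by move=> [m [n ->]]; exists (- m), (- n); rewrite !mulrNz opprD.
Qed.

Lemma covolume_Zspan (v w : R[i]) : complex.Im (v^* * w) != 0 ->
  has_covolume (Zspan v w) `|complex.Im (v^* * w)|.
Proof.
(* One of v, w has nonzero real part, since otherwise Im (conj v * w) = 0. *)
wlog v0 : v w / complex.Re v != 0 => [wl D0|D0].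
  have [v0|] := eqVneq (complex.Re v) 0; last by move=> v0; exact: wl.
  have DC : complex.Im (w^* * v) = - complex.Im (v^* * w) by rewrite !Im_conjM; ring.
  rewrite ZspanC -normrN -DC; apply: wl; last by rewrite DC oppr_eq0.
  by apply: contraNneq D0 => w0; rewrite Im_conjM v0 w0 mul0r mulr0 subrr.
have hF := fundamental_sheared _ _ v0 D0.
split=> [|G hG]; first by exists (sheared_domain v w).
rewrite -area_sheared //.
exact: area_fundamental_domain_uniq (countable_Zspan v w) (Zspan_opp v w) hG hF.
Qed.

Lemma plane_lattice_Zspan (v w : R[i]) : complex.Im (v^* * w) != 0 ->
  plane_lattice (Zspan v w).
Proof.
move=> D0; exists v, w; split=> // a b.
case: v w D0 => [v1 v2] [w1 w2] /= D0 [e1 e2].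
have c0 (c : R) : c * (v1 * w2 - v2 * w1) = 0 -> c = 0.
  move/eqP; rewrite mulf_eq0 => /orP[/eqP//|h].
  by case/negP: D0; rewrite -(eqP h); apply/eqP; ring.
(* Cramer's rule: eliminate one coefficient between e1 and e2. *)
split; apply: c0.
  rewrite (_ : _ * _ = (a * v1 - 0 * v2 + (b * w1 - 0 * w2)) * w2
     - (a * v2 + 0 * v1 + (b * w2 + 0 * w1)) * w1); last by ring.
  by rewrite e1 e2; ring.
rewrite (_ : _ * _ = v1 * (a * v2 + 0 * v1 + (b * w2 + 0 * w1))
   - v2 * (a * v1 - 0 * v2 + (b * w1 - 0 * w2))); last by ring.
by rewrite e1 e2; ring.
Qed.

End Plane.

(** * Cross products of projected vectors *)

Lemma row3E (T : Type) (a b c : T) :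
  ((row3 a b c 0 i1 = a) * (row3 a b c 0 i2 = b) * (row3 a b c 0 i3 = c))%type.
Proof. by rewrite !mxE !tnth3E. Qed.

Lemma row3_eq (T : Type) (u v : 'rV[T]_3) :
  u 0 i1 = v 0 i1 -> u 0 i2 = v 0 i2 -> u 0 i3 = v 0 i3 -> u = v.
Proof.
move=> e1 e2 e3; apply/rowP => -[[|[|[|//]]] h].
- by rewrite (_ : Ordinal h = i1) //; apply: val_inj.
- by rewrite (_ : Ordinal h = i2) //; apply: val_inj.
- by rewrite (_ : Ordinal h = i3) //; apply: val_inj.
Qed.

Lemma norm2Z (R : realType) (c : R) (v : 'rV[R]_3) : norm2 (c *: v) = `|c| * norm2 v.
Proof.
rewrite /norm2 (_ : dot (c *: v) _ = c ^+ 2 * dot v v).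
  by rewrite sqrtrM ?sqr_ge0 // sqrtr_sqr.
rewrite /dot !sum3E !mxE; ring.
Qed.

Section Projections.
Context (R : realType) (K : fieldExtType rat).
Context (sr : {rmorphism K -> R}) (sc : {rmorphism K -> R[i]}).

(** The left side is orthogonal to both projections, which lie in the plane
orthogonal to xi, so it is a multiple of xi. *)
Lemma cross_perp (s : 3.-tuple K) (a b : 'rV[R]_3) :
  dot (xi sr s) (xi sr s) != 0 ->
  cross (perp sr s a) (perp sr s b) =
  (det3 (xi sr s) a b / dot (xi sr s) (xi sr s)) *: xi sr s.
Proof.
move=> x0.
have perpE (v : 'rV[R]_3) i : perp sr s v 0 i =
    v 0 i - dot v (xi sr s) / dot (xi sr s) (xi sr s) * xi sr s 0 i.
  rewrite !mxE -norm2_sq expr2 invfM /dot !sum3E !mxE; ring.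
move: x0; set x := xi sr s; rewrite det3E /dot !sum3E => x0.
apply: row3_eq; rewrite [RHS]mxE /cross !row3E !perpE /dot !sum3E -/x; field;
  exact: x0.
Qed.

Lemma cross_dev (L : {pred K}) (s : 3.-tuple K) : is_state sr L s ->
  cross (perp sr s (re_nu sc s)) (perp sr s (im_nu sc s)) =
  row3 (P sr sc s i2 i3) (- P sr sc s i1 i3) (P sr sc s i1 i2).
Proof.
move=> hs.
apply: row3_eq; rewrite /cross !row3E /P !Im_conjM !(dev_perp sc _ hs) /=; ring.
Qed.

End Projections.

(** * Independence of the embeddings *)

Section Independence.
Context (R : realType) (K : fieldExtType rat).
Context (sr : {rmorphism K -> R}) (sc : {rmorphism K -> R[i]}).

(** Dedekind's argument made explicit. Evaluate at 1, y and y ^ 2 for a y with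
sc y = p + i q nonreal, and put t = sr y: eliminating b and c leaves
a * |sc y - t| ^ 2 = 0, with a positive second factor as q <> 0. *)
Lemma embedding_combination_eq0 (a b c : R) : ~ real_embedding sc ->
  (forall y, a * sr y + b * complex.Re (sc y) + c * complex.Im (sc y) = 0) ->
  [/\ a = 0, b = 0 & c = 0].
Proof.
move=> nreal h.
have [y /eqP qn0] : exists y, complex.Im (sc y) <> 0.
  by apply: contrapT => hn; apply: nreal => y; apply: contrapT => hy; apply: hn; exists y.
have := h 1; rewrite !rmorph1 /= mulr1 mulr1 mulr0 addr0 => h1.
have := h (y ^+ 2); rewrite !rmorphXn /=.
have := h y; move: qn0.
case: (sc y) => p q /= qn0; rewrite !expr2 /=; set t := sr y => hy hy2.
have bE : b = - a by apply/eqP; rewrite -addr_eq0 addrC h1.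
have : a * ((t - p) ^+ 2 + q ^+ 2) = 0.
  rewrite -[RHS]add0r -[X in _ = X + _]hy2 -[X in _ = _ + X](mulr0 (- 2 * p)).
  by rewrite -[X in _ = _ + _ * X]hy bE; ring.
move/eqP; rewrite mulf_eq0 orbC gt_eqF /=; last first.
  by rewrite ltr_wpDl ?sqr_ge0 // exprn_even_gt0.
move=> /eqP a0; have b0 : b = 0 by rewrite bE a0 oppr0.
split=> //; move/eqP: hy; rewrite a0 b0 !mul0r !add0r mulf_eq0 (negbTE qn0) orbF.
by move/eqP.
Qed.

Lemma rmorph_ratZ (F : fieldType) (f : {rmorphism K -> F}) (q : rat) (y : K) :
  f (q *: y) = ratr q * f y.
Proof.
by rewrite -mulr_algl rmorphM -(fmorph_eq_rat (f \o in_alg K)).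
Qed.

(** The rational coordinates of y in the basis s are preserved by both
embeddings, so a vanishing combination of the rows of the matrix vanishes at
every y in K. *)
Lemma det_embeddings_neq0 (s : 3.-tuple K) :
  ~ real_embedding sc -> basis_of {:K} s ->
  det3 (xi sr s) (re_nu sc s) (im_nu sc s) != 0.
Proof.
move=> nreal bs; apply/negP => /det0P[v vn0 vM].
have [] := embedding_combination_eq0 (v 0 i1) (v 0 i2) (v 0 i3) nreal.
  move=> y; rewrite (coord_basis bs (memvf y)).
  rewrite !raddf_sum /= !mulr_sumr -!big_split /= big1 // => i _.
  have := congr1 (fun u : 'rV[R]_3 => u 0 i) vM.
  rewrite mxE sum3E !mxE !(tnth_nth 0) => vi.
  have ratC (q : rat) : ratr q = (ratr q)%:C :> R[i] by rewrite fmorph_rat.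
  rewrite !rmorph_ratZ ratC.
  move: vi; case: (sc _) => p q /= vi.
  by rewrite -[RHS](mulr0 (ratr (coord s i y))) -[X in _ = _ * X]vi; ring.
move=> e1 e2 e3; case/eqP: vn0.
by apply: row3_eq; rewrite ?e1 ?e2 ?e3 mxE.
Qed.

End Independence.

Theorem theorem3p3 (R : realType) (K : fieldExtType rat)
    (hdim : \dim {:K} = 3%N) (hsig : has_signature R K 1 1)
    (sr : {rmorphism K -> R}) (sc : {rmorphism K -> R[i]})
    (hsc : ~ real_embedding sc)
    (L : {pred K}) (hL : is_order L)
    (s : 3.-tuple K) (hs : is_state sr L s) :
  let x := xi sr s in
  let w := dev sr sc s in
  let P := P sr sc s in
  let A := A_perp sr sc s in
  let d := delta sr sc s in
  [/\ (* (a) *)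
      A ^+ 2 = P i1 i2 ^+ 2 + P i1 i3 ^+ 2 + P i2 i3 ^+ 2,
      (* (b) *)
      exists c : R,
        [/\ row3 (P i2 i3) (- P i1 i3) (P i1 i2) = c *: x,
            `|c| = A / norm2 x
          & A / norm2 x = d / (2 * norm2 x ^+ 2)]
    & (* (c) *)
      [/\ [/\ plane_lattice (Zspan (w i2) (w i3)),
              has_covolume (Zspan (w i2) (w i3)) `|P i2 i3|
            & `|P i2 i3| = d * x 0 i1 / (2 * norm2 x ^+ 2)],
          [/\ plane_lattice (Zspan (w i1) (w i3)),
              has_covolume (Zspan (w i1) (w i3)) `|P i1 i3|
            & `|P i1 i3| = d * x 0 i2 / (2 * norm2 x ^+ 2)]
        & [/\ plane_lattice (Zspan (w i1) (w i2)),
              has_covolume (Zspan (w i1) (w i2)) `|P i1 i2|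
            & `|P i1 i2| = d * x 0 i3 / (2 * norm2 x ^+ 2)]]].
Proof.
move=> x w P0 A d.
have crossE := cross_dev R K sr sc L s hs.
have xx0 : 0 < dot x x := dot_xi_gt0 hs.
have nx0 : norm2 x != 0 by rewrite -sqrf_eq0 norm2_sq gt_eqF.
have xpos i : 0 < x 0 i by rewrite mxE; case: hs.
have det0 : det3 x (re_nu sc s) (im_nu sc s) != 0.
  by apply: det_embeddings_neq0 => //; case: hs.
pose c := det3 x (re_nu sc s) (im_nu sc s) / dot x x.
have c0 : c != 0 by rewrite mulf_neq0 // invr_neq0 // gt_eqF.
have PE : row3 (P0 i2 i3) (- P0 i1 i3) (P0 i1 i2) = c *: x.
  by rewrite -crossE cross_perp // gt_eqF.
have AE : A = `|c| * norm2 x by rewrite -norm2Z -PE /A /A_perp crossE.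
have cE : `|c| = d / (2 * norm2 x ^+ 2).
  rewrite norm2_sq /d /delta -/x /c normrM normfV (gtr0_norm xx0).
  by field; rewrite gt_eqF.
have P23 : P0 i2 i3 = c * x 0 i1 by rewrite -[LHS](row3E _ _ (- P0 i1 i3) (P0 i1 i2)) PE mxE.
have P13 : P0 i1 i3 = - (c * x 0 i2).
  by rewrite -[LHS]opprK -(row3E _ (P0 i2 i3) (- P0 i1 i3) (P0 i1 i2)) PE mxE.
have P12 : P0 i1 i2 = c * x 0 i3 by rewrite -[LHS](row3E _ (P0 i2 i3) (- P0 i1 i3)) PE mxE.
have lattice i j k : `|P0 i j| = `|c * x 0 k| ->
  [/\ plane_lattice (Zspan (w i) (w j)),
      has_covolume (Zspan (w i) (w j)) `|P0 i j|
    & `|P0 i j| = d * x 0 k / (2 * norm2 x ^+ 2)].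
  move=> Pij.
  have Pn0 : P0 i j != 0 by rewrite -normr_eq0 Pij normr_eq0 mulf_neq0 // gt_eqF.
  split; [exact: plane_lattice_Zspan | exact: covolume_Zspan |].
  by rewrite Pij normrM (gtr0_norm (xpos k)) cE mulrAC.
split.
- rewrite /A /A_perp norm2_sq crossE /dot sum3E !row3E -/P0; ring.
- by exists c; rewrite -cE AE mulfK.
- by split; apply: lattice; rewrite ?P23 ?P13 ?P12 ?normrN.
Qed.
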